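(* Let the quadruples $$\mbox{(D)}\quad M_j=\left(\begin{array}{cc}N_j&0\\0&P_j\end{array}\right),\qquad \mbox{(S)}\quad M_j=\left(\begin{array}{cc}N_j&R_j\\0&N_j\end{array}\right),\qquad j=1,\ldots,4,$$ be as in the context. The centralizers in $SL(4,{\bf C})$ of a quadruple (D) and of a quadruple (S) are both of dimension $1$. They consist respectively of the matrices $$\left(\begin{array}{cc}\alpha I&0\\0&\pm\alpha^{-1}I\end{array}\right)\quad\mbox{and}\quad\left(\begin{array}{cc}\delta I&\beta I\\0&\delta I\end{array}\right),\qquad \alpha\in{\bf C}^*,~\beta\in{\bf C},~\delta^4=1.$$
   Context: Let $\alpha_j,\beta_j\in{\bf C}^*$, $\alpha_j\ne\beta_j$, $j=1,2,3$, satisfy $\alpha_1\beta_1\alpha_2\beta_2\alpha_3\beta_3=1$ and be relatively generic: for integers $m\in\{1,2,3\}$ and $k_1,k_2,k_3$ with $0\le k_j\le2$, $0\le m-k_j\le2$, the equality $(-1)^m\prod_{j=1}^3\alpha_j^{k_j}\beta_j^{m-k_j}=1$ holds only for $m=2$, $k_1=k_2=k_3=1$. For $j=1,2,3$ let $C_j\subset GL(4,{\bf C})$ be the conjugacy class of diagonalizable matrices with eigenvalues $\alpha_j,\beta_j$, each of multiplicity $2$; let $C_4$ be the conjugacy class of matrices with the single eigenvalue $-1$ and with three Jordan blocks, of sizes $2,1,1$. Quadruples of matrices $N_j\in GL(2,{\bf C})$: $N_j$ is diagonalizable with eigenvalues $\alpha_j,\beta_j$ for $j=1,2,3$, $N_4=-I$,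 $N_1N_2N_3N_4=I$. Quadruples of matrices $P_j\in GL(2,{\bf C})$: $P_j$ is diagonalizable with eigenvalues $\alpha_j,\beta_j$ for $j=1,2,3$, $P_4$ is conjugate to a Jordan block of size $2$ with eigenvalue $-1$, $P_1P_2P_3P_4=I$. (By the genericity of the eigenvalues all such quadruples are irreducible.) A quadruple (D) is formed from any such $(N_j)$, $(P_j)$. A quadruple (S) is formed from such $(N_j)$ and $R_j\in gl(2,{\bf C})$ such that $M_j\in C_j$ for $j=1,\ldots,4$ (so $M_1,M_2,M_3$ are diagonalizable and ${\rm rk}\,R_4=1$) and $M_1M_2M_3M_4=I$. The centralizer of a quadruple in $SL(4,{\bf C})$ is the group of matrices of $SL(4,{\bf C})$ commuting with all four matrices. *)

(* Defs.v *)
From HB Require Import structures.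
From mathcomp Require Import all_boot all_order all_algebra.
From mathcomp Require Import complex mpoly classical_sets reals.

Set Implicit Arguments.
Unset Strict Implicit.
Unset Printing Implicit Defensive.

Import Order.TTheory GRing.Theory Num.Theory.
Local Open Scope ring_scope.
Local Open Scope classical_set_scope.

(** * Dimension of a subset of the affine space of n x n matrices

    The dimension is the Krull dimension for the Zariski topology.  For an
    algebraic group over the complex numbers it agrees with the dimension as a
    complex Lie group. *)

Section Dimension.
Variables (F : fieldType) (n : nat).
Implicit Types Y Z V W : set 'M[F]_n.

Definition zariski_closed Z : Prop :=
  exists S : set {mpoly F[n * n]},
    Z = [set X | forall p, S p -> p.@[fun i => mxvec X 0 i] = 0].

Definition zariski_closed_in Y Z : Prop :=
  exists2 V, zariski_closed V & Z = Y `&` V.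

Definition zariski_irreducible Z : Prop :=
  Z !=set0 /\
  forall V W, zariski_closed V -> zariski_closed W ->
    Z `<=` V `|` W -> Z `<=` V \/ Z `<=` W.

(* c 0 < c 1 < ... < c d; the values c i with i > d are irrelevant. *)
Definition irreducible_chain Y (d : nat) (c : nat -> set 'M[F]_n) : Prop :=
  (forall i, (i <= d)%N -> zariski_closed_in Y (c i) /\ zariski_irreducible (c i))
  /\ (forall i, (i < d)%N -> c i `<` c i.+1).

Definition has_dimension Y (d : nat) : Prop :=
  (exists c, irreducible_chain Y d c) /\
  (forall e c, irreducible_chain Y e c -> (e <= d)%N).

End Dimension.

Section Quadruples.
Variable F : fieldType.

Definition relatively_generic (al be : 'I_3 -> F) : Prop :=
  forall (m : nat) (k : 'I_3 -> nat),
    (1 <= m <= 3)%N ->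
    (forall j, [&& k j <= 2, k j <= m & m - k j <= 2])%N ->
    (-1) ^+ m * \prod_(j < 3) (al j ^+ k j * be j ^+ (m - k j)) = 1 ->
    m = 2%N /\ forall j, k j = 1%N.

Definition diagonalizable_with n (r : nat) (a b : F) (A : 'M[F]_n) : Prop :=
  [/\ A \in unitmx, diagonalizable A &
      char_poly A = ('X - a%:P) ^+ r * ('X - b%:P) ^+ r].

Definition jordan_block n (a : F) : 'M[F]_n :=
  \matrix_(i, j) (a *+ (i == j) + (j == i.+1 :> nat)%:R).

Definition jordan_211 (a : F) : 'M[F]_(2 + 2) :=
  block_mx (jordan_block 2 a) 0
           0 (block_mx (jordan_block 1 a) 0 0 (jordan_block 1 a) : 'M_(1 + 1)).

(* Indices start at 0: the first three matrices of a quadruple are indexed by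
   first3 j with j : 'I_3, and the fourth one by ord_max. *)
Definition first3 (j : 'I_3) : 'I_4 := widen_ord (leqnSn 3) j.

Definition N_quadruple (al be : 'I_3 -> F) (N : 'I_4 -> 'M[F]_2) : Prop :=
  [/\ forall j, diagonalizable_with 1 (al j) (be j) (N (first3 j)),
      N ord_max = - 1%:M & \prod_(j < 4) N j = 1%:M].

Definition P_quadruple (al be : 'I_3 -> F) (P : 'I_4 -> 'M[F]_2) : Prop :=
  [/\ forall j, diagonalizable_with 1 (al j) (be j) (P (first3 j)),
      similar_in unitmx (P ord_max) (jordan_block 2 (-1)) &
      \prod_(j < 4) P j = 1%:M].

Definition C_quadruple (al be : 'I_3 -> F) (M : 'I_4 -> 'M[F]_(2 + 2)) : Prop :=
  [/\ forall j, diagonalizable_with 2 (al j) (be j) (M (first3 j)),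
      similar_in unitmx (M ord_max) (jordan_211 (-1)) &
      \prod_(j < 4) M j = 1%:M].

Definition quadD (N P : 'I_4 -> 'M[F]_2) (j : 'I_4) : 'M[F]_(2 + 2) :=
  block_mx (N j) 0 0 (P j).

Definition quadS (N R : 'I_4 -> 'M[F]_2) (j : 'I_4) : 'M[F]_(2 + 2) :=
  block_mx (N j) (R j) 0 (N j).

Definition centralizer_SL n (M : 'I_4 -> 'M[F]_n) : set 'M[F]_n :=
  [set X | \det X = 1 /\ forall j, X *m M j = M j *m X].

End Quadruples.

(* Main.v *)
(** By genericity with [m = 1], the matrices [N_j] have no common eigenvector,
    and neither have the [P_j]; so Schur's lemma applies to the four blocks of a
    commuting matrix.  The two representations are not equivalent because
    [N_4 = - I] while [P_4] is not scalar, and in case (S) comparing the fourth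
    matrices, where [R_4 <> 0], kills the lower left block and equates the
    diagonal ones.

    Each centralizer is then a finite union of closed curves (hyperbolas or
    lines) with a rational parametrization.  A polynomial pulls back to a
    rational function of one variable, so a closed set contains such a curve or
    meets it in finitely many points; hence the proper irreducible closed
    subsets of the curve are points, and the dimension is 1. *)

Require Import Defs.
From HB Require Import structures.
From mathcomp Require Import all_boot all_order all_algebra.
From mathcomp Require Import complex mpoly classical_sets reals.
From mathcomp Require Import finmap boolp cardinality.

Set Implicit Arguments.
Unset Strict Implicit.
Unset Printing Implicit Defensive.

Import Order.TTheory GRing.Theory Num.Theory.
Local Open Scope ring_scope.
Local Open Scope classical_set_scope.

(** * Schur's lemma in dimension 2 *)

Section Schur.
Variables (F : fieldType) (I : finType).
Implicit Types M N P : I -> 'M[F]_2.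

(** Irreducibility for the action on row vectors: in dimension 2 a proper nonzero invariant subspace
    is a line. *)
Definition no_invariant_line M : Prop :=
  forall v : 'rV_2, (forall j, (v *m M j <= v)%MS) -> v = 0.

(** If [x *m B = 0] then [x *m N j *m B = x *m B *m P j = 0], so the row kernel of [B] is stable
    under the [N j]. For [B] singular and nonzero this kernel would be an invariant line. *)
Lemma intertwiner_unit N P (B : 'M_2) : no_invariant_line N ->
  (forall j, B *m P j = N j *m B) -> B != 0 -> B \in unitmx.
Proof.
move=> irrN BP B_neq0; apply: contraT => nuB.
have rB : \rank B = 1%N.
  have := rank_leq_col B; rewrite leq_eqVlt => /predU1P[rB | ].
    by case/negP: nuB; rewrite -row_full_unit /row_full rB.
  by rewrite ltnS leq_eqVlt ltnS leqn0 mxrank_eq0 (negPf B_neq0) orbF => /eqP.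
have rK : \rank (kermx B) = 1%N by rewrite mxrank_ker rB.
have K_neq0 : kermx B != 0 by rewrite -mxrank_eq0 rK.
set v := nz_row (kermx B).
have v_neq0 : v != 0 by rewrite nz_row_eq0.
have vK : (v <= kermx B)%MS by exact: nz_row_sub.
have Kv : (kermx B <= v)%MS.
  have [_ ] := mxrank_leqif_sup vK.
  by rewrite rK rank_rV v_neq0 eqxx => <-.
case/eqP: v_neq0; apply: irrN => j; apply: submx_trans Kv.
apply/sub_kermxP; rewrite -mulmxA -BP mulmxA.
by rewrite (sub_kermxP vK) mul0mx.
Qed.

End Schur.

(** For an eigenvalue [a] of [A], the matrix [A - a%:M] still commutes with the [N j] and is
    singular, so it vanishes. *)
Lemma endomorphism_scalar (F : closedFieldType) (I : finType)
    (N : I -> 'M[F]_2) (A : 'M[F]_2) : no_invariant_line N ->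
  (forall j, A *m N j = N j *m A) -> exists a : F, A = a%:M.
Proof.
move=> irrN AN.
have [a /eqP ra] : exists a, root (char_poly A) a.
  by apply/closed_rootP; rewrite size_char_poly.
exists a; apply/eqP; rewrite -subr_eq0; apply: contraT => nz.
have /negP[] : ~~ eigenvalue A a.
  rewrite /eigenvalue /eigenspace kermx_eq0 negbK row_free_unit.
  apply: (intertwiner_unit (P := N) irrN _ nz) => j.
  by rewrite mulmxBl mulmxBr AN scalar_mxC.
by rewrite eigenvalue_root_char; apply/eqP.
Qed.

(** * From generic eigenvalues to irreducible quadruples *)

Section Genericity.
Variables (F : fieldType) (al be : 'I_3 -> F).

Lemma prod_eigenvector n (s : seq 'I_4) (M : 'I_4 -> 'M[F]_n.+1) x (v : 'rV_n.+1) :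
  (forall j, v *m M j = x j *: v) ->
  v *m (\prod_(j <- s) M j) = (\prod_(j <- s) x j) *: v.
Proof.
move=> vM; elim: s => [|j s IHs]; first by rewrite !big_nil scale1r mulmx1.
by rewrite !big_cons mulmxA vM -scalemxAl IHs scalerA.
Qed.

Lemma diagonalizable_with_eigenvalue (a b x : F) (A : 'M_2) (v : 'rV_2) :
  diagonalizable_with 1 a b A -> v != 0 -> v *m A = x *: v -> x = a \/ x = b.
Proof.
case=> _ _ charA v_neq0 vA.
have : eigenvalue A x by apply/eigenvalueP; exists v.
rewrite eigenvalue_root_char charA !expr1 rootM !root_XsubC.
by case/orP=> /eqP; [left | right].
Qed.

(* Only the case m = 1 of the genericity hypothesis is used: an invariant line
   picks one eigenvalue of each matrix, and their product would be 1. *)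
Lemma generic_no_invariant_line (M : 'I_4 -> 'M[F]_2) :
  relatively_generic al be ->
  (forall j, diagonalizable_with 1 (al j) (be j) (M (first3 j))) ->
  (forall x (v : 'rV_2), v != 0 -> v *m M ord_max = x *: v -> x = -1) ->
  \prod_(j < 4) M j = 1%:M -> no_invariant_line M.
Proof.
move=> gen M123 M4 prodM v vM; apply/eqP; apply: contraT => v_neq0.
have [x vx] : exists x, forall j, v *m M j = x j *: v.
  by apply: (fin_all_exists (P := fun j a => v *m M j = a *: v)) => j; apply/sub_rVP.
have x4 : x ord_max = -1 by apply: M4 (vx _).
have x123 j : x (first3 j) = al j \/ x (first3 j) = be j.
  exact: diagonalizable_with_eigenvalue (M123 j) v_neq0 (vx _).
have := prod_eigenvector (index_enum 'I_4) vx.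
rewrite prodM mulmx1 => /eqP; rewrite -subr_eq0 -[X in X - _]scale1r -scalerBl.
rewrite scaler_eq0 (negPf v_neq0) orbF subr_eq0 => /eqP prodx.
(* With these exponents and [m = 1], the product in the genericity condition is that of the chosen
   eigenvalues, the sign [(-1) ^+ 1] being the eigenvalue of the fourth matrix. Genericity then
   yields the absurd [1 = 2]. *)
pose k j : nat := (x (first3 j) == al j).
have [] // := gen 1%N k isT; last 1 first.
- rewrite [RHS]prodx [RHS]big_ord_recr /= x4 expr1 mulrC; congr (_ * _).
  apply: eq_bigr => j _; rewrite /k -/(first3 j).
  case: eqP => [-> | ne]; first by rewrite expr1 expr0 mulr1.
  by case: (x123 j) => // ->; rewrite expr1 expr0 mul1r.
- by move=> j; rewrite /k; case: eqP.
Qed.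

Lemma N_quadruple_no_invariant_line N :
  relatively_generic al be -> N_quadruple al be N -> no_invariant_line N.
Proof.
move=> gen [N123 N4 prodN]; apply: generic_no_invariant_line => // x v v_neq0.
rewrite N4 mulmxN mulmx1 -scaleN1r => /eqP.
by rewrite -subr_eq0 -scalerBl scaler_eq0 (negPf v_neq0) orbF subr_eq0 => /eqP.
Qed.

Lemma jordan_block2_sqr (a : F) :
  (jordan_block 2 a - a%:M) *m (jordan_block 2 a - a%:M) = 0.
Proof.
apply/matrixP => i k; rewrite !mxE !big_ord_recl big_ord0 !mxE.
case: i => [[|[|//]] ?]; case: k => [[|[|//]] ?] /=;
  by rewrite !(mulr1n, mulr0n, addr0, subr0, subrr, addrK, add0r, mulr0, mul0r).
Qed.

(** The fourth matrix is conjugate to a Jordan block [J] with [(J + 1)^2 = 0], so any eigenvalue [x]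
    of it satisfies [(x + 1)^2 = 0]. *)
Lemma P_quadruple_no_invariant_line P :
  relatively_generic al be -> P_quadruple al be P -> no_invariant_line P.
Proof.
move=> gen [P123 [Q uQ /similarRL simP] prodP].
apply: generic_no_invariant_line => // x v v_neq0 vP.
have {simP} PQ : jordan_block 2 (-1) = Q *m P ord_max *m invmx Q by exact: simP.
pose w := v *m invmx Q.
have w_neq0 : w != 0.
  apply: contra v_neq0 => /eqP w0; by rewrite -(mulmxKV uQ v) -/w w0 mul0mx.
have wJ : w *m (jordan_block 2 (-1) - (-1)%:M) = (x + 1) *: w.
  rewrite mulmxBr PQ /w !mulmxA mulmxKV // vP -scalemxAl mul_mx_scalar.
  by rewrite scaleN1r opprK scalerDl scale1r.
have : w *m (jordan_block 2 (-1) - (-1)%:M) *m (jordan_block 2 (-1) - (-1)%:M) = 0.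
  by rewrite -mulmxA jordan_block2_sqr mulmx0.
rewrite wJ -scalemxAl wJ scalerA => /eqP; rewrite scaler_eq0 (negPf w_neq0) orbF.
by rewrite mulf_eq0 orbb addr_eq0 => /eqP.
Qed.

End Genericity.

(** * Zariski closed sets, irreducibility and dimension *)

Section ZariskiClosed.
Variables (F : fieldType) (n : nat).
Implicit Types (V W Z C : set 'M[F]_n) (f : 'M[F]_n -> F).

(** Allows equations of closed sets to be written in the matrix entries, without exhibiting elements
    of [{mpoly F[n * n]}]. *)
Definition polynomial_fun f : Prop :=
  exists p : {mpoly F[n * n]}, forall X, f X = p.@[fun i => mxvec X 0 i].

Lemma polynomial_coord i j : polynomial_fun (fun X => X i j).
Proof. by exists 'X_(mxvec_index i j) => X; rewrite mevalXU mxvecE. Qed.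

Lemma polynomial_cst c : polynomial_fun (fun=> c).
Proof. by exists c%:MP => X; rewrite mevalC. Qed.

Lemma polynomialB f g :
  polynomial_fun f -> polynomial_fun g -> polynomial_fun (fun X => f X - g X).
Proof. by move=> [p fp] [q gq]; exists (p - q) => X; rewrite mevalB fp gq. Qed.

Lemma polynomialD f g :
  polynomial_fun f -> polynomial_fun g -> polynomial_fun (fun X => f X + g X).
Proof. by move=> [p fp] [q gq]; exists (p + q) => X; rewrite mevalD fp gq. Qed.

Lemma polynomialM f g :
  polynomial_fun f -> polynomial_fun g -> polynomial_fun (fun X => f X * g X).
Proof. by move=> [p fp] [q gq]; exists (p * q) => X; rewrite mevalM fp gq. Qed.

Lemma zariski_closed_zeros (T : Type) (f : T -> 'M[F]_n -> F) :
  (forall t, polynomial_fun (f t)) -> zariski_closed [set X | forall t, f t X = 0].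
Proof.
move=> /choice[p fp]; exists (range p).
apply/seteqP; split=> X /= fX; first by move=> _ [t _ <-]; rewrite -fp.
by move=> t; rewrite fp; apply: fX; exists t.
Qed.

Lemma zariski_closedI V W :
  zariski_closed V -> zariski_closed W -> zariski_closed (V `&` W).
Proof.
move=> [S ->] [T ->]; exists (S `|` T); apply/seteqP; split=> X /=.
  by move=> [SX TX] p []; [apply: SX | apply: TX].
by move=> STX; split=> p ?; apply: STX; [left | right].
Qed.

(** The union is cut out by the products [p * q]: at a point outside [V] some [p] is nonzero, and
    cancelling it leaves every equation [q] of [W]. *)
Lemma zariski_closedU V W :
  zariski_closed V -> zariski_closed W -> zariski_closed (V `|` W).
Proof.
move=> [S ->] [T ->]; exists [set r | exists p q, [/\ S p, T q & r = p * q]].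
apply/seteqP; split=> X /=.
  by move=> [SX|TX] _ [p [q [Sp Tq ->]]]; rewrite mevalM;
    [rewrite (SX p Sp) mul0r | rewrite (TX q Tq) mulr0].
move=> STX; have [|] := pselect (forall p, S p -> p.@[fun i => mxvec X 0 i] = 0).
  by left.
move=> /existsNP[p /not_implyP[Sp pX]]; right=> q Tq.
have /eqP : (p * q).@[fun i => mxvec X 0 i] = 0 by apply: STX; exists p, q.
by rewrite mevalM mulf_eq0 => /predU1P[//|/eqP].
Qed.

Lemma zariski_closed_set0 : zariski_closed (set0 : set 'M[F]_n).
Proof.
exists [set 1]; apply/seteqP; split=> X //= /(_ 1 erefl) /eqP.
by rewrite meval1 oner_eq0.
Qed.

Lemma zariski_closed_set1 (A : 'M[F]_n) : zariski_closed [set A].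
Proof.
rewrite (_ : [set A] = [set X | forall ij, X ij.1 ij.2 - A ij.1 ij.2 = 0]).
  by apply: zariski_closed_zeros => ij;
    apply: polynomialB; [apply: polynomial_coord | apply: polynomial_cst].
apply/seteqP; split=> X /=; first by move=> -> ij; rewrite subrr.
by move=> XA; apply/matrixP => i j; apply/eqP; rewrite -subr_eq0 (XA (i, j)).
Qed.

Lemma zariski_closed_bigcup (I : eqType) (s : seq I) (C_ : I -> set 'M[F]_n) :
  (forall i, i \in s -> zariski_closed (C_ i)) ->
  zariski_closed [set X | exists2 i, i \in s & C_ i X].
Proof.
elim: s => [|i s IHs] clC.
  rewrite (_ : mkset _ = set0); first exact: zariski_closed_set0.
  by apply/seteqP; split=> X // [].
rewrite (_ : mkset _ = C_ i `|` [set X | exists2 i, i \in s & C_ i X]).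
  apply: zariski_closedU; first by apply: clC; rewrite mem_head.
  by apply: IHs => j js; apply: clC; rewrite inE js orbT.
apply/seteqP; split=> X /=.
  by move=> [j /predU1P[->|js] CX]; [left | right; exists j].
by move=> [CX|[j js CX]]; [exists i; rewrite ?mem_head | exists j; rewrite // inE js orbT].
Qed.

Lemma zariski_irreducible_bigcup (I : eqType) (s : seq I) (C_ : I -> set 'M[F]_n) Z :
  zariski_irreducible Z -> (forall i : I, i \in s -> zariski_closed (C_ i)) ->
  Z `<=` [set X | exists2 i, i \in s & C_ i X] -> exists2 i, i \in s & Z `<=` C_ i.
Proof.
move=> [Z0 irrZ]; elim: s => [|i s IHs] clC ZC.
  by case: Z0 => X /ZC[].
have cls j : j \in s -> zariski_closed (C_ j).
  by move=> js; apply: clC; rewrite inE js orbT.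
have [] := irrZ (C_ i) [set X | exists2 j, j \in s & C_ j X].
- by apply: clC; rewrite mem_head.
- exact: zariski_closed_bigcup.
- by move=> X /ZC[j /predU1P[->|js] CX]; [left | right; exists j].
- by move=> ZCi; exists i; rewrite ?mem_head.
- by move=> /(IHs cls)[j js ZCj]; exists j; rewrite // inE js orbT.
Qed.

(** A finite set is the finite union of its points, which are closed; irreducibility puts it inside
    one of them. *)
Lemma zariski_irreducible_finite Z :
  finite_set Z -> zariski_irreducible Z -> exists A, Z = [set A].
Proof.
move=> /finite_seqP[s Zs] irrZ.
have [| |A _ ZA] := zariski_irreducible_bigcup (s := s) (C_ := set1) irrZ.
- by move=> A _; apply: zariski_closed_set1.
- by move=> X; rewrite Zs => Xs; exists X.
exists A; apply/seteqP; split=> // X ->.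
by case: irrZ => -[B ZB] _; rewrite -(ZA B ZB).
Qed.

(** Topological substitute for an irreducible closed curve: in the induced topology the proper
    closed subsets are exactly the finite ones. *)
Definition zariski_curve C : Prop :=
  [/\ infinite_set C, zariski_closed C &
      forall V, zariski_closed V -> C `<=` V \/ finite_set (C `&` V)].

(** Otherwise the infinite set [C] would be covered by two finite intersections. *)
Lemma zariski_curve_irreducible C : zariski_curve C -> zariski_irreducible C.
Proof.
move=> [infC _ cofC]; split; first exact: infinite_setN0.
move=> V W clV clW CVW.
have [|finV] := cofC V clV; first by left.
have [|finW] := cofC W clW; first by right.
case: infC; apply: sub_finite_set (_ : finite_set ((C `&` V) `|` (C `&` W))).
  by move=> X CX; have [] := CVW X CX; [left | right].
by rewrite finite_setU.
Qed.

Lemma zariski_irreducible_set1 (A : 'M[F]_n) : zariski_irreducible [set A].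
Proof.
split; first by exists A.
by move=> V W _ _ /(_ A erefl)[]; [left | right] => X ->.
Qed.

Lemma has_dimension_curves (I : eqType) (s : seq I) (C_ : I -> set 'M[F]_n) i0 :
  i0 \in s -> (forall i, i \in s -> zariski_curve (C_ i)) ->
  has_dimension [set X | exists2 i, i \in s & C_ i X] 1.
Proof.
set Y := mkset _ => i0s curveC; split.
  have [infC clC _] := curveC i0 i0s.
  have [A CA] := infinite_setN0 infC.
  (* Lower bound: the chain formed by a point of the curve [C_ i0] and the curve itself. *)
  exists (fun k => if k is 0%N then [set A] else C_ i0); split=> [[|k] _|[|k] //= _].
  - split; last exact: zariski_irreducible_set1.
    exists [set A]; first exact: zariski_closed_set1.
    by apply/seteqP; split=> X; [move=> ->; split=> //; exists i0 | case].
  - split; last exact: zariski_curve_irreducible (curveC _ i0s).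
    exists (C_ i0) => //.
    by apply/seteqP; split=> X; [move=> CX; split=> //; exists i0 | case].
  - split=> [X -> //|CA1]; apply: infC.
    exact: sub_finite_set CA1 (finite_set1 A).
(* Upper bound: in a chain with three terms, [c 2] lies in a single curve, [c 1] is then finite,
   hence a point, and [c 0] cannot be strictly smaller and nonempty. *)
move=> e c [c_irr c_lt]; rewrite leqNgt; apply/negP => e_gt1.
have [[V2 _ c2E] irr2] := c_irr 2%N e_gt1.
have [[V1 clV1 c1E] irr1] := c_irr 1%N (ltnW e_gt1).
have [_ [[X0 c0X] _]] := c_irr 0%N isT.
have [c01 nc10] := c_lt 0%N (ltnW e_gt1).
have [c12 nc21] := c_lt 1%N e_gt1.
have [i si c2C] : exists2 i, i \in s & c 2%N `<=` C_ i.
  apply: zariski_irreducible_bigcup irr2 _ _ => [j /curveC[]//|].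
  by rewrite c2E => X [].
have [_ _ cofC] := curveC i si.
have fin1 : finite_set (c 1%N).
  (* If [V1] contained the whole curve, then [c 2] would be included in [c 1]. *)
  have [CV1|] := cofC V1 clV1.
    case: nc21 => X c2X; rewrite c1E; split; first by exists i => //; apply: c2C.
    by apply/CV1/c2C.
  apply: sub_finite_set => X c1X; split; first by apply/c2C/c12.
  by move: c1X; rewrite c1E => -[].
have [A c1A] := zariski_irreducible_finite fin1 irr1.
apply: nc10 => X; rewrite c1A => ->.
by have := c01 X0 c0X; rewrite c1A => <-.
Qed.

End ZariskiClosed.

(** * Rationally parametrized curves *)

Section RationalCurves.
Variables (F : fieldType) (D : set F).
Implicit Types f g : F -> F.

(** One fraction must represent [f] on all of [D], with no pole there, so that the zeros of [f] in
    [D] are roots of a single numerator. *)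
Definition rational_on f : Prop := exists q h : {poly F},
  forall a, D a -> h.[a] != 0 /\ f a = q.[a] / h.[a].

Lemma rational_cst c : rational_on (fun=> c).
Proof. by exists c%:P, 1 => a _; rewrite !hornerE divr1 oner_neq0. Qed.

Lemma rational_id : rational_on id.
Proof. by exists 'X, 1 => a _; rewrite !hornerE divr1 oner_neq0. Qed.

Lemma rationalD f g :
  rational_on f -> rational_on g -> rational_on (fun a => f a + g a).
Proof.
move=> [q [h fE]] [r [k gE]]; exists (q * k + r * h), (h * k) => a Da.
have [[h0 ->] [k0 ->]] := (fE a Da, gE a Da).
by rewrite hornerD !hornerM mulf_neq0 // addf_div.
Qed.

Lemma rationalM f g :
  rational_on f -> rational_on g -> rational_on (fun a => f a * g a).
Proof.
move=> [q [h fE]] [r [k gE]]; exists (q * r), (h * k) => a Da.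
have [[h0 ->] [k0 ->]] := (fE a Da, gE a Da).
by rewrite !hornerM mulf_neq0 //; split=> //; rewrite mulf_div.
Qed.

Lemma rationalX f k : rational_on f -> rational_on (fun a => f a ^+ k).
Proof.
move=> ratf; elim: k => [|k IHk]; first exact: rational_cst.
by under eq_fun do rewrite exprS; apply: rationalM.
Qed.

Lemma rational_meval n (v : F -> 'I_n -> F) (p : {mpoly F[n]}) :
  (forall i, rational_on (v^~ i)) -> rational_on (fun a => p.@[v a]).
Proof.
move=> ratv; under eq_fun do rewrite mevalE.
(* The outer induction runs over the monomials of [p], the inner one over the variables. *)
elim: (msupp p : seq _) => [|m s IHs].
  by under eq_fun do rewrite big_nil; apply: rational_cst.
under eq_fun do rewrite big_cons.
apply: rationalD => //; apply: rationalM; first exact: rational_cst.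
elim: (index_enum _) => [|i t IHt].
  by under eq_fun do rewrite big_nil; apply: rational_cst.
by under eq_fun do rewrite big_cons; apply: rationalM => //; apply: rationalX.
Qed.

(** A nonzero numerator [q] has fewer than [size q] roots, whereas an infinite zero set would supply
    at least [size q] distinct ones. *)
Lemma rational_zeros f : rational_on f ->
  (forall a, D a -> f a = 0) \/ finite_set [set a | D a /\ f a = 0].
Proof.
move=> [q [h fE]]; have [q0 | q_neq0] := eqVneq q 0.
  by left=> a /fE[_ ->]; rewrite q0 horner0 mul0r.
right; apply: contrapT => /(@infinite_set_fset _ _ (size q))[B BZ].
rewrite leqNgt => /negP; apply; apply: max_poly_roots (fset_uniq B) => //.
apply/allP => a aB; have [Da] := BZ a aB.
have [h0 ->] := fE a Da; move/eqP.
by rewrite mulf_eq0 invr_eq0 (negPf h0) orbF.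
Qed.

(** Each equation of a closed set pulls back along [phi] to a rational function. Either all
    pullbacks vanish on [D], or one of them has finitely many zeros there, and their images contain
    the whole intersection. *)
Lemma rational_curve n (phi : F -> 'M[F]_n) :
  (forall i j, rational_on (fun a => phi a i j)) ->
  zariski_closed (phi @` D) -> infinite_set (phi @` D) ->
  zariski_curve (phi @` D).
Proof.
move=> ratphi clC infC; split=> // _ [S ->].
pose ev (p : {mpoly F[n * n]}) a := p.@[fun i => mxvec (phi a) 0 i].
have [Cp|] := pselect (forall p, S p -> forall a, D a -> ev p a = 0).
  by left=> _ [a Da <-] p Sp; apply: Cp.
move=> /existsNP[p /not_implyP[Sp pC]]; right.
have /rational_zeros[//|finp] : rational_on (ev p).
  apply: rational_meval => i; case/mxvec_indexP: i => i j.
  by under eq_fun do rewrite mxvecE.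
apply: sub_finite_set (finite_image phi finp) => _ [[a Da <-] Sa].
by exists a => //; split=> //; apply: Sa.
Qed.

End RationalCurves.

(** * Hyperbolas and lines of block matrices *)

Section Blocks.
Variable F : fieldType.
Implicit Types (a b d e : F) (D : set F).

(** Common shape of both centralizers: [b = 0] occurs in case (D), [a = d] in case (S). *)
Definition scalar_ublock a b d : 'M[F]_(2 + 2) := block_mx a%:M b%:M 0 d%:M.

(** The entries at [(u, u)], [(u, w)] and [(w, w)] recover the three parameters of a
    [scalar_ublock]. *)
Let u : 'I_(2 + 2) := lshift 2 0.
Let w : 'I_(2 + 2) := rshift 2 0.

(** Linearity in the parameters reduces polynomiality and rationality of the entries to the closure
    lemmas. *)
Lemma scalar_ublock_entry a b d i j :
  scalar_ublock a b d i j = a * scalar_ublock 1 0 0 i j +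
    b * scalar_ublock 0 1 0 i j + d * scalar_ublock 0 0 1 i j.
Proof.
have -> : scalar_ublock a b d = a *: scalar_ublock 1 0 0 +
    b *: scalar_ublock 0 1 0 + d *: scalar_ublock 0 0 1.
  rewrite /scalar_ublock !scale_block_mx !add_block_mx !scale_scalar_mx.
  by rewrite !(mulr1, mulr0, raddf0, scaler0, addr0, add0r).
by rewrite [LHS]mxE [X in X + _]mxE; congr (_ + _ + _); rewrite [LHS]mxE.
Qed.

(** Having the block shape is itself a system of linear equations: [X] equals the block matrix
    rebuilt from three of its entries. *)
Lemma zariski_closed_scalar_ublock (T : Type) (f : T -> 'M[F]_(2 + 2) -> F) :
  (forall t, polynomial_fun (f t)) ->
  zariski_closed [set X : 'M[F]_(2 + 2) | X = scalar_ublock (X u u) (X u w) (X w w) /\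
                                        forall t, f t X = 0].
Proof.
move=> polf.
pose g ij (X : 'M[F]_(2 + 2)) : F :=
  X ij.1 ij.2 - scalar_ublock (X u u) (X u w) (X w w) ij.1 ij.2.
rewrite (_ : mkset _ = [set X | forall ij, g ij X = 0] `&`
                       [set X | forall t, f t X = 0]).
  apply: zariski_closedI; apply: zariski_closed_zeros => // ij; rewrite /g.
  under eq_fun do rewrite scalar_ublock_entry.
  by do !(apply: polynomialB || apply: polynomialD || apply: polynomialM
       || apply: polynomial_coord || apply: polynomial_cst).
apply/seteqP; split=> X [XT fX]; split=> //=.
  by move=> ij; rewrite /g -XT subrr.
by apply/matrixP => i j; apply/eqP; rewrite -subr_eq0; apply/eqP/(XT (i, j)).
Qed.

Lemma rational_scalar_ublock D (f g h : F -> F) i j :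
  rational_on D f -> rational_on D g -> rational_on D h ->
  rational_on D (fun a => scalar_ublock (f a) (g a) (h a) i j).
Proof.
move=> ratf ratg rath; under eq_fun do rewrite scalar_ublock_entry.
by do !(apply: rationalD || apply: rationalM) => //; apply: rational_cst.
Qed.

Lemma scalar_ublockE a b d :
  (scalar_ublock a b d u u = a) * (scalar_ublock a b d u w = b) *
  (scalar_ublock a b d w w = d).
Proof.
by rewrite /scalar_ublock block_mxEul block_mxEur block_mxEdr !mxE eqxx !mulr1n.
Qed.

Lemma hyperbola_curve e : infinite_set [set a : F | a != 0] -> e != 0 ->
  zariski_curve [set scalar_ublock a 0 (e / a) | a in [set a | a != 0]].
Proof.
move=> infF e0; apply: rational_curve => [i j||].
- apply: rational_scalar_ublock; [exact: rational_id | exact: rational_cst |].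
  by exists e%:P, 'X => a a0; rewrite !hornerE.
(* Besides the block shape, two equations: the upper right block is zero, and the diagonal
   parameters have product [e]. Since [e] is nonzero, so is the first parameter. *)
- pose f (t : bool) (X : 'M[F]_(2 + 2)) := if t then X u w else X u u * X w w - e.
  rewrite (_ : image _ _ = [set X : 'M[F]_(2 + 2) | X = scalar_ublock (X u u) (X u w) (X w w) /\
                                    forall t, f t X = 0]).
    apply: zariski_closed_scalar_ublock => -[]; first exact: polynomial_coord.
    apply: polynomialB (polynomial_cst _ _).
    by apply: polynomialM; apply: polynomial_coord.
  apply/seteqP; split=> X /=.
    move=> [a a0 <-]; rewrite !scalar_ublockE; split=> // -[].
      by rewrite /f scalar_ublockE.
    by rewrite /f !scalar_ublockE mulrC divfK ?subrr.
  move=> [XE fX]; have X0 : X u w = 0 := fX true; have /eqP := fX false.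
  rewrite /f subr_eq0 => /eqP Xe.
  have Xuu : X u u != 0 by apply: contra_neq e0 => X0'; rewrite -Xe X0' mul0r.
  by exists (X u u) => //; rewrite [RHS]XE X0 -Xe mulrAC divff ?mul1r.
- apply: contra_not infF => /(finite_image (fun X : 'M[F]_(2 + 2) => X u u)).
  apply: sub_finite_set => a a0; exists (scalar_ublock a 0 (e / a)).
    by exists a.
  by rewrite scalar_ublockE.
Qed.

Lemma line_curve d : infinite_set [set: F] ->
  zariski_curve [set scalar_ublock d b d | b in [set: F]].
Proof.
move=> infF; apply: rational_curve => [i j||].
- by apply: rational_scalar_ublock; [| exact: rational_id |]; apply: rational_cst.
(* Both diagonal parameters are fixed to [d]; the upper right one is free and parametrizes the
   line. *)
- pose f (t : bool) (X : 'M[F]_(2 + 2)) := if t then X u u - d else X w w - d.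
  rewrite (_ : image _ _ = [set X : 'M[F]_(2 + 2) | X = scalar_ublock (X u u) (X u w) (X w w) /\
                                    forall t, f t X = 0]).
    by apply: zariski_closed_scalar_ublock => -[];
      apply: polynomialB (polynomial_cst _ _); apply: polynomial_coord.
  apply/seteqP; split=> X /=.
    by move=> [b _ <-]; rewrite !scalar_ublockE; split=> // -[];
      rewrite /f scalar_ublockE subrr.
  move=> [XE fX]; have /eqP := fX true; have /eqP := fX false.
  rewrite /f !subr_eq0 => /eqP Xw /eqP Xu.
  by exists (X u w) => //; rewrite [RHS]XE Xu Xw.
- apply: contra_not infF => /(finite_image (fun X : 'M[F]_(2 + 2) => X u w)).
  apply: sub_finite_set => b _; exists (scalar_ublock d b d); first by exists b.
  by rewrite scalar_ublockE.
Qed.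

End Blocks.

(** Characteristic 0: the elements [k.+1%:R] are nonzero and pairwise distinct. *)
Lemma infinite_nonzero (F : numDomainType) : infinite_set [set a : F | a != 0].
Proof.
move=> /(@finite_preimage _ _ _ (fun k : nat => k.+1%:R : F)) fin.
apply: infinite_nat; apply: sub_finite_set (fin _) => [k _ | k l _ _ /eqP].
  by rewrite /= pnatr_eq0.
by rewrite eqr_nat => /eqP[].
Qed.

(** * Explicit form of the centralizers *)

Section Centralizers.
Variables (F : closedFieldType) (al be : 'I_3 -> F).
Hypothesis gen : relatively_generic al be.
Implicit Types N P S : 'I_4 -> 'M[F]_2.

Lemma jordan_block2_neq_scalar (a c : F) : jordan_block 2 a <> c%:M.
Proof.
move=> /matrixP /(_ 0 1); rewrite !mxE /= add0r => /eqP.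
by rewrite oner_eq0.
Qed.

Lemma P_quadruple_neq_scalar P c : P_quadruple al be P -> P ord_max <> c%:M.
Proof.
move=> [_ [Q uQ /similarRL simP] _] P4; apply: (@jordan_block2_neq_scalar (-1) c).
have -> : jordan_block 2 (-1) = Q *m P ord_max *m invmx Q by exact: simP.
by rewrite P4 mul_mx_scalar -scalemxAl mulmxV // scalemx1.
Qed.

(** With [S ord_max = 0] the fourth matrix would be [-I], conjugate only to itself, while
    [jordan_211 (-1)] contains a Jordan block of size 2. *)
Lemma C_quadruple_neq0 N S :
  N_quadruple al be N -> C_quadruple al be (quadS N S) -> S ord_max != 0.
Proof.
move=> [_ N4 _] [_ [Q uQ /similarRL simM] _]; apply/eqP => S0.
have JE : jordan_211 (-1) = Q *m quadS N S ord_max *m invmx Q by exact: simM.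
apply: (@jordan_block2_neq_scalar (-1) (-1)).
rewrite -[LHS](block_mxKul _ _ _ _ : ulsubmx (jordan_211 (-1)) = _) JE.
rewrite /quadS S0 N4 -scaleN1r scalemx1 -scalar_mx_block mul_mx_scalar.
by rewrite -scalemxAl mulmxV // scalemx1 scalar_mx_block block_mxKul.
Qed.

Lemma centralizer_quadD N P : N_quadruple al be N -> P_quadruple al be P ->
  centralizer_SL (quadD N P) =
  [set X | exists2 a, a != 0 & X = block_mx a%:M 0 0 (a^-1)%:M \/
                               X = block_mx a%:M 0 0 (- a^-1)%:M].
Proof.
move=> quadN quadP; have [_ N4 _] := quadN.
have irrN := N_quadruple_no_invariant_line gen quadN.
have irrP := P_quadruple_no_invariant_line gen quadP.
apply/seteqP; split=> X /=; last first.
  (* Both signs are treated at once through [e] with [e ^+ 2 = 1]. *)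
  case=> a a0 XE; have [e e2 {}XE] :
      exists2 e : F, e ^+ 2 = 1 & X = block_mx a%:M 0 0 (e / a)%:M.
    case: XE => ->; [exists 1 | exists (-1)]; rewrite ?sqrrN ?expr1n //.
      by rewrite mul1r.
    by rewrite mulN1r.
  rewrite XE; split=> [|j].
    by rewrite det_ublock !det_scalar -exprMn mulrCA divff // mulr1.
  rewrite /quadD !mulmx_block !(mulmx0, mul0mx, addr0, add0r).
  by rewrite !mul_scalar_mx !mul_mx_scalar.
rewrite -[X]submxK; move: (ulsubmx X) (ursubmx X) (dlsubmx X) (drsubmx X).
move=> A B C D [detX comX].
have {}comX j : [/\ A *m N j = N j *m A, B *m P j = N j *m B,
                    C *m N j = P j *m C & D *m P j = P j *m D].
  have := comX j; rewrite /quadD !mulmx_block !(mulmx0, mul0mx, addr0, add0r).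
  by move=> /eq_block_mx[-> -> -> ->].
have [a AE] := endomorphism_scalar irrN (fun j => let: And4 h _ _ _ := comX j in h).
have [d DE] := endomorphism_scalar irrP (fun j => let: And4 _ _ _ h := comX j in h).
(* An invertible [B] would conjugate [P ord_max] to [N ord_max = -I], making it scalar; the same
   holds for [C] below. *)
have B0 : B = 0.
  apply/eqP/contraT => B_neq0.
  have uB : B \in unitmx by apply: (intertwiner_unit (P := P) irrN _ B_neq0) => j; case: (comX j).
  case: (@P_quadruple_neq_scalar P (-1) quadP); have [_ BP _ _] := comX ord_max.
  rewrite -(mulKmx uB (P ord_max)) BP N4 mulNmx mul1mx mulmxN mulVmx //.
  by rewrite -scaleN1r scalemx1.
have C0 : C = 0.
  apply/eqP/contraT => C_neq0.
  have uC : C \in unitmx by apply: (intertwiner_unit (P := N) irrP _ C_neq0) => j; case: (comX j).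
  case: (@P_quadruple_neq_scalar P (-1) quadP); have [_ _ CN _] := comX ord_max.
  rewrite -(mulmxK uC (P ord_max)) -CN N4 mulmxN mulmx1 mulNmx mulmxV //.
  by rewrite -scaleN1r scalemx1.
(* The determinant is [(a * d) ^+ 2], whence the two signs of [d]. *)
move: detX; rewrite B0 C0 AE DE det_ublock !det_scalar -exprMn => /eqP.
rewrite sqrf_eq1 => ad.
have a0 : a != 0.
  by apply: contraTneq ad => ->; rewrite mul0r !(eq_sym 0) oppr_eq0 orbb oner_eq0.
exists a => //; case/orP: ad => /eqP ad; [left | right].
  by rewrite -(mulKf a0 d) ad mulr1.
by rewrite -(mulKf a0 d) ad mulrN1.
Qed.

Lemma centralizer_quadS N S :
  N_quadruple al be N -> C_quadruple al be (quadS N S) ->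
  centralizer_SL (quadS N S) =
  [set X | exists b d, d ^+ 4 = 1 /\ X = block_mx d%:M b%:M 0 d%:M].
Proof.
move=> quadN quadC; have [_ N4 _] := quadN.
have irrN := N_quadruple_no_invariant_line gen quadN.
have S4 := C_quadruple_neq0 quadN quadC.
apply/seteqP; split=> X /=; last first.
  case=> b [d [d4 ->]]; split=> [|j]; first by rewrite det_ublock !det_scalar -exprD.
  rewrite /quadS !mulmx_block !(mulmx0, mul0mx, addr0, add0r).
  by rewrite !mul_scalar_mx !mul_mx_scalar addrC.
rewrite -[X]submxK; move: (ulsubmx X) (ursubmx X) (dlsubmx X) (drsubmx X).
move=> A B C D [detX comX].
have {}comX j : [/\ A *m N j = N j *m A + S j *m C,
                    A *m S j + B *m N j = N j *m B + S j *m D,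
                    C *m N j = N j *m C & C *m S j + D *m N j = N j *m D].
  have := comX j; rewrite /quadS !mulmx_block !(mulmx0, mul0mx, addr0, add0r).
  by move=> /eq_block_mx[-> -> -> ->].
have N4C Y : N ord_max *m Y = Y *m N ord_max by rewrite N4 mulNmx mulmxN mul1mx mulmx1.
have [c CE] := endomorphism_scalar irrN (fun j => let: And4 _ _ h _ := comX j in h).
(* Since [N ord_max = -I] is central, the upper left relation for the fourth matrices reduces to
   [S ord_max *m C = 0], that is, [c *: S ord_max = 0]. *)
have c0 : c = 0.
  have [/eqP + _ _ _] := comX ord_max.
  rewrite N4C -subr_eq0 opprD addNKr CE mul_mx_scalar oppr_eq0.
  by rewrite scaler_eq0 (negPf S4) orbF => /eqP.
have C0 : C = 0 by rewrite CE c0 raddf0.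
have [a AE] : exists a, A = a%:M.
  by apply: endomorphism_scalar irrN _ => j; have [-> _ _ _] := comX j;
    rewrite C0 mulmx0 addr0.
have [d DE] : exists d, D = d%:M.
  by apply: endomorphism_scalar irrN _ => j; have [_ _ _ <-] := comX j;
    rewrite C0 mul0mx add0r.
(* The upper right relation for the fourth matrices likewise reduces to
   [(a - d) *: S ord_max = 0]. *)
have ad : a = d.
  have [_ /eqP + _ _] := comX ord_max; rewrite N4C addrC (inj_eq (addrI _)).
  rewrite AE DE mul_scalar_mx mul_mx_scalar -subr_eq0 -scalerBl scaler_eq0.
  by rewrite (negPf S4) orbF subr_eq0 => /eqP.
(* As [A] and [D] are the same scalar matrix, the terms in [S j] cancel and [B] commutes with every
   [N j]. *)
have [b BE] : exists b, B = b%:M.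
  apply: endomorphism_scalar irrN _ => j; have [_ + _ _] := comX j.
  by rewrite AE DE ad mul_scalar_mx mul_mx_scalar addrC => /addIr.
exists b, d; rewrite C0 AE BE DE ad; split=> //.
by move: detX; rewrite AE C0 DE ad det_ublock !det_scalar -exprD.
Qed.

End Centralizers.

Theorem proposition21 (R : realType) (al be : 'I_3 -> R[i])
    (al_neq0 : forall j, al j != 0) (be_neq0 : forall j, be j != 0)
    (al_neq_be : forall j, al j != be j)
    (prod1 : \prod_(j < 3) (al j * be j) = 1)
    (gen : relatively_generic al be) :
  (forall N P : 'I_4 -> 'M[R[i]]_2,
     N_quadruple al be N -> P_quadruple al be P ->
     has_dimension (centralizer_SL (quadD N P)) 1 /\
     centralizer_SL (quadD N P) =
       [set X | exists2 a : R[i], a != 0 &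
                  X = block_mx a%:M 0 0 (a^-1)%:M \/
                  X = block_mx a%:M 0 0 (- a^-1)%:M])
  /\
  (forall N S : 'I_4 -> 'M[R[i]]_2,
     N_quadruple al be N -> C_quadruple al be (quadS N S) ->
     has_dimension (centralizer_SL (quadS N S)) 1 /\
     centralizer_SL (quadS N S) =
       [set X | exists b d : R[i], d ^+ 4 = 1 /\
                  X = block_mx d%:M b%:M 0 d%:M]).
Proof.
have infF := @infinite_nonzero R[i].
split=> [N P quadN quadP | N S quadN quadC].
  rewrite (centralizer_quadD gen quadN quadP); split=> //.
  (* Case (D) is the union of the two hyperbolas with [e = 1] and [e = -1]. *)
  have /(@has_dimension_curves _ _ _ [:: 1; -1] _ 1 (mem_head _ _)) :
      forall e : R[i], e \in [:: 1; -1] -> zariski_curve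
        [set scalar_ublock a 0 (e / a) | a in [set a | a != 0]].
    move=> e; rewrite !inE => eE; apply: hyperbola_curve => //.
    by case/orP: eE => /eqP ->; rewrite ?oppr_eq0 oner_eq0.
  congr (has_dimension _ 1); rewrite /scalar_ublock raddf0.
  apply/seteqP; split=> X /=.
    move=> [e]; rewrite !inE => /orP[] /eqP -> [a a0 <-]; exists a => //.
      by left; rewrite mul1r.
    by right; rewrite mulN1r.
  move=> [a a0 [->|->]]; [exists 1 | exists (-1)]; rewrite ?inE ?eqxx ?orbT //.
    by exists a => //; rewrite mul1r.
  by exists a => //; rewrite mulN1r.
rewrite (centralizer_quadS gen quadN quadC); split=> //.
(* The list [s] of roots of [X^4 - 1] indexes the lines of case (S), one for each fourth root of
   unity. *)
have [s] := closed_field_poly_normal ('X^4 - 1 : {poly R[i]}).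
rewrite lead_coefDl ?size_polyXn ?size_polyN ?size_poly1 // lead_coefXn scale1r => sE.
have s_root d : (d \in s) = (d ^+ 4 == 1).
  by rewrite -root_prod_XsubC -sE rootE !hornerE subr_eq0.
have s1 : 1 \in s by rewrite s_root expr1n.
have /(has_dimension_curves s1) : forall d, d \in s -> zariski_curve
    [set scalar_ublock d b d | b in [set: R[i]]].
  move=> d _; apply: line_curve; apply: contra_not infF.
  exact: sub_finite_set.
congr (has_dimension _ 1); apply/seteqP; split=> X /=.
  by move=> [d]; rewrite s_root => /eqP d4 [b _ <-]; exists b, d.
by move=> [b [d [d4 ->]]]; exists d; rewrite ?s_root ?d4 //; exists b.
Qed.
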